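(* Let $G$ be a well-founded win or lose game. For each player $i\in\{1,2\}$, with opponent $-i$, we have $\mathit{win}_i(G)\neq\emptyset$ if and only if $\mathit{win}_{-i}(G)=\emptyset$.
   Context: A two-player extensive game with perfect information is $G=(T,\mathit{turn},p_1,p_2)$, where $T=(V,E)$ is a (possibly infinite) rooted tree with edges directed away from the root and set of leaves $Z$, $\mathit{turn}:V\setminus Z\to\{1,2\}$ says who moves at each non-leaf node, and $p_i:Z\to\mathbb{R}$ is the payoff function of player $i$. The game is well-founded if $T$ has no infinite paths. The opponent of player $i$ is denoted $-i$. A strategy of player $i$ is a function $s_i$ assigning to each non-leaf node $u$ with $\mathit{turn}(u)=i$ a child of $u$; $S_i$ is the set of these strategies. In a well-founded game, following a joint strategy $s=(s_i,s_{-i})$ from the root leads to a unique leaf, denoted $\mathit{leaf}(s)$. $G$ is a win or lose game if the only possible outcomes (values of $(p_1,p_2)$ at leaves) are $(1,-1)$ and $(-1,1)$. A strategy $s_i\in S_i$ is a winning strategy of player $i$ if for all $s_{-i}\in S_{-i}$, $p_i(\mathit{leaf}(s_i,s_{-i}))=1$. $\mathit{win}_i(G)$ is the (possibly empty) set of winning strategies of player $i$ in $G$. *)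

(* Defs.v *)
From Stdlib Require Import Reals List Relations Ensembles.
From Stdlib Require Import Classical ClassicalEpsilon ProofIrrelevance.

(* [p] lists the successive nodes of a directed walk from [x] to [y], with the
   starting node [x] left out. *)
Fixpoint walk {V : Type} (E : V -> V -> Prop) (x : V) (p : list V) (y : V) : Prop :=
  match p with
  | nil => x = y
  | z :: q => E x z /\ walk E z q y
  end.

(* Uniqueness ranges over walks, so it also excludes directed cycles, parallel
   branches that meet again, and edges into the root. *)
Record rooted_tree : Type := RootedTree {
  node :> Type;
  edge : node -> node -> Prop;
  root : node;
  unique_walk : forall v : node, exists! p : list node, walk edge root p v
}.

Arguments edge {r} _ _.
Arguments root {r}.

Definition is_leaf {T : rooted_tree} (u : T) : Prop := forall w : T, ~ edge u w.

Definition leaf_node (T : rooted_tree) : Type := {u : T | is_leaf u}.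

Definition inner_node (T : rooted_tree) : Type := {u : T | ~ is_leaf u}.

Definition child {T : rooted_tree} (u : T) : Type := {w : T | edge u w}.

Inductive player : Set := player1 | player2.

Definition opponent (i : player) : player :=
  match i with player1 => player2 | player2 => player1 end.

Record game : Type := Game {
  tree : rooted_tree;
  turn : inner_node tree -> player;
  payoff : player -> leaf_node tree -> R
}.

Arguments turn {g} _.
Arguments payoff {g} _ _.

Definition well_founded_game (G : game) : Prop :=
  ~ exists f : nat -> tree G, forall n : nat, edge (f n) (f (S n)).

Definition win_or_lose (G : game) : Prop :=
  forall z : leaf_node (tree G),
    (payoff player1 z, payoff player2 z) = (1, -1)%R \/
    (payoff player1 z, payoff player2 z) = (-1, 1)%R.

Definition strategy (G : game) (i : player) : Type :=
  forall u : inner_node (tree G), turn u = i -> child (proj1_sig u).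

Definition joint_strategy (G : game) : Type := forall i : player, strategy G i.

Definition join {G : game} (i : player) :
    strategy G i -> strategy G (opponent i) -> joint_strategy G :=
  match i return strategy G i -> strategy G (opponent i) -> joint_strategy G with
  | player1 => fun s1 s2 j =>
      match j with player1 => s1 | player2 => s2 end
  | player2 => fun s2 s1 j =>
      match j with player1 => s1 | player2 => s2 end
  end.

Definition move {G : game} (s : joint_strategy G) (u : inner_node (tree G)) :
    child (proj1_sig u) :=
  s (turn u) u eq_refl.

Definition step {G : game} (s : joint_strategy G) (u w : tree G) : Prop :=
  exists H : ~ is_leaf u, w = proj1_sig (move s (exist _ u H)).

Definition reaches {G : game} (s : joint_strategy G) : tree G -> tree G -> Prop :=
  clos_refl_trans_1n (tree G) (step s).

Lemma step_functional (G : game) (s : joint_strategy G) (u w w' : tree G) :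
  step s u w -> step s u w' -> w = w'.
Proof.
  intros [H ->] [H' ->]. now rewrite (proof_irrelevance _ H H').
Qed.

Lemma leaf_no_step (G : game) (s : joint_strategy G) (u w : tree G) :
  is_leaf u -> ~ step s u w.
Proof. intros Hu [H _]. exact (H Hu). Qed.

Lemma reaches_leaf_unique (G : game) (s : joint_strategy G) (u z z' : tree G) :
  reaches s u z -> is_leaf z -> reaches s u z' -> is_leaf z' -> z = z'.
Proof.
  intros Hz Lz. revert z'. induction Hz as [u | u v z Huv Hvz IH]; intros z' Hz' Lz'.
  - destruct Hz' as [| v z' Huv Hvz']; [reflexivity |].
    exfalso. exact (leaf_no_step _ _ _ _ Lz Huv).
  - destruct Hz' as [| v' z' Huv' Hvz'].
    + exfalso. exact (leaf_no_step _ _ _ _ Lz' Huv).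
    + rewrite (step_functional _ _ _ _ _ Huv' Huv) in Hvz'. now apply IH.
Qed.

Lemma reaches_some_leaf (G : game) (wf : well_founded_game G)
    (s : joint_strategy G) (u : tree G) :
  exists z : tree G, reaches s u z /\ is_leaf z.
Proof.
  apply NNPP. intros Hno.
  set (next := fun v : tree G =>
    match excluded_middle_informative (is_leaf v) with
    | left _ => v
    | right H => proj1_sig (move s (exist _ v H))
    end).
  set (f := fix f (n : nat) : tree G :=
    match n with O => u | S m => next (f m) end).
  assert (Hstep : forall v, ~ is_leaf v -> step s v (next v)).
  { intros v Hv. unfold next.
    destruct (excluded_middle_informative (is_leaf v)) as [L | H];
      [contradiction | now exists H]. }
  assert (Hf : forall n, clos_refl_trans _ (step s) u (f n)
                         /\ ~ is_leaf (f n)).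
  { assert (Hinner : forall v, clos_refl_trans _ (step s) u v -> ~ is_leaf v).
    { intros v Hv L. apply Hno. exists v. split; [| exact L].
      now apply clos_rt_rt1n. }
    induction n as [| n [IH IH']].
    - split; [| apply Hinner]; apply rt_refl.
    - assert (H : clos_refl_trans _ (step s) u (f (S n))).
      { eapply rt_trans; [exact IH |]. apply rt_step. now apply Hstep. }
      split; [exact H | now apply Hinner]. }
  apply wf. exists f. intros n.
  destruct (Hstep (f n) (proj2 (Hf n))) as [H E].
  change (f (S n)) with (next (f n)). rewrite E.
  exact (proj2_sig (move s (exist _ (f n) H))).
Qed.

Lemma reaches_unique_leaf (G : game) (wf : well_founded_game G)
    (s : joint_strategy G) :
  exists! z : leaf_node (tree G), reaches s root (proj1_sig z).
Proof.
  destruct (reaches_some_leaf G wf s root) as [z [Hz Lz]].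
  exists (exist _ z Lz). split; [exact Hz |].
  intros [z' Lz'] Hz'. simpl in Hz'.
  assert (E : z = z') by exact (reaches_leaf_unique _ _ _ _ _ Hz Lz Hz' Lz').
  subst z'. now rewrite (proof_irrelevance _ Lz Lz').
Qed.

Definition leaf {G : game} (wf : well_founded_game G) (s : joint_strategy G) :
    leaf_node (tree G) :=
  proj1_sig (constructive_definite_description _ (reaches_unique_leaf G wf s)).

Lemma leaf_reached (G : game) (wf : well_founded_game G) (s : joint_strategy G) :
  reaches s root (proj1_sig (leaf wf s)).
Proof.
  exact (proj2_sig
    (constructive_definite_description _ (reaches_unique_leaf G wf s))).
Qed.

Definition winning_strategy {G : game} (wf : well_founded_game G) (i : player)
    (si : strategy G i) : Prop :=
  forall so : strategy G (opponent i), payoff i (leaf wf (join i si so)) = 1%R.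

Definition win {G : game} (wf : well_founded_game G) (i : player) :
    Ensemble (strategy G i) :=
  fun si => winning_strategy wf i si.

(* Main.v *)
(** Backward induction: let [secured i u] be the least predicate stating that
    player [i] can force a win from the node [u].  An infinite path could be
    built from any node secured by neither player, so the root is secured by
    some player; always moving to a secured child when there is one is then
    winning for that player.  Conversely, two winning strategies played against
    each other would reach a leaf won by both players. *)

Require Import Defs.
From Stdlib Require Import Reals Ensembles.
From Stdlib Require Import Classical ClassicalEpsilon ProofIrrelevance.
From Stdlib Require Import FunctionalExtensionality PropExtensionality Lra.

Inductive secured {G : game} (i : player) : tree G -> Prop :=
| secured_leaf (z : leaf_node (tree G)) :
    payoff i z = 1%R -> secured i (proj1_sig z)
| secured_own (u : inner_node (tree G)) (w : child (proj1_sig u)) :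
    turn u = i -> secured i (proj1_sig w) -> secured i (proj1_sig u)
| secured_opponent (u : inner_node (tree G)) :
    turn u = opponent i ->
    (forall w : child (proj1_sig u), secured i (proj1_sig w)) ->
    secured i (proj1_sig u).

Lemma inner_node_child {T : rooted_tree} (u : inner_node T) :
  inhabited (child (proj1_sig u)).
Proof.
  destruct u as [u Hu]; simpl.
  apply NNPP; intros Hno; apply Hu; intros w Hw.
  apply Hno; constructor; now exists w.
Qed.

(** Classical [epsilon] makes the strategy total: where no child is secured it still returns some
    unspecified child. *)
Definition greedy {G : game} (i : player) : strategy G i :=
  fun u _ => epsilon (inner_node_child u) (fun w => secured i (proj1_sig w)).

Lemma greedy_secured {G : game} (i : player) (u : inner_node (tree G))
    (Hu : turn u = i) (w : child (proj1_sig u)) :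
  secured i (proj1_sig w) -> secured i (proj1_sig (greedy i u Hu)).
Proof.
  intros Hw; unfold greedy.
  apply (epsilon_spec (inner_node_child u) (fun w => secured i (proj1_sig w))).
  now exists w.
Qed.

Lemma move_turn {G : game} (s : joint_strategy G) (i : player)
    (u : inner_node (tree G)) (Hu : turn u = i) :
  move s u = s i u Hu.
Proof. now destruct Hu. Qed.

Lemma player_or_opponent (i j : player) : j = i \/ j = opponent i.
Proof. destruct i, j; auto. Qed.

(** At a node of [i] some child is secured, so [greedy] picks such a child; at a node of the
    opponent every child is secured, whatever [s] plays there. *)
Lemma secured_step {G : game} (i : player) (s : joint_strategy G)
    (u w : tree G) :
  s i = greedy i -> step s u w -> secured i u -> secured i w.
Proof.
  intros Hs [Hu ->] Hsec.
  (* Case analysis yields [u] with a fresh proof [Hv] of being inner; proof irrelevance identifies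
     it with [Hu]. *)
  remember u as v eqn:Ev in Hsec.
  destruct Hsec as [[z Hz] _ | [v Hv] w Ht Hw | [v Hv] Ht Hall]; simpl in *;
    subst u; try contradiction; rewrite (proof_irrelevance _ Hu Hv).
  - rewrite (move_turn s i _ Ht), Hs; exact (greedy_secured i _ Ht w Hw).
  - apply Hall.
Qed.

Lemma secured_reaches {G : game} (i : player) (s : joint_strategy G)
    (u w : tree G) :
  s i = greedy i -> reaches s u w -> secured i u -> secured i w.
Proof.
  intros Hs; induction 1 as [| u v w Huv _ IH]; intros Hu; auto.
  apply IH; exact (secured_step i s u v Hs Huv Hu).
Qed.

(** The last two constructors of [secured] apply to inner nodes only, so a leaf is secured through
    its payoff. *)
Lemma payoff_secured_leaf {G : game} (i : player) (z : leaf_node (tree G)) :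
  secured i (proj1_sig z) -> payoff i z = 1%R.
Proof.
  destruct z as [z Hz]; simpl; intros Hsec.
  remember z as v eqn:Ev in Hsec.
  destruct Hsec as [[v Hv] Hp | [v Hv] w _ _ | [v Hv] _ _]; simpl in *; subst z;
    try contradiction.
  now rewrite (proof_irrelevance _ Hz Hv).
Qed.

Lemma join_own {G : game} (i : player) (si : strategy G i)
    (so : strategy G (opponent i)) :
  join i si so i = si.
Proof. now destruct i. Qed.

Lemma secured_root_winning {G : game} (wf : well_founded_game G) (i : player) :
  secured i (@root (tree G)) -> winning_strategy wf i (greedy i).
Proof.
  intros Hroot so; apply payoff_secured_leaf.
  exact (secured_reaches i _ _ _ (join_own i _ so) (leaf_reached G wf _) Hroot).
Qed.

Lemma win_or_lose_payoff {G : game} (Hwl : win_or_lose G) (i : player)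
    (z : leaf_node (tree G)) :
  payoff i z = 1%R <-> payoff (opponent i) z <> 1%R.
Proof.
  destruct i, (Hwl z) as [E | E]; injection E as E1 E2; simpl;
    rewrite E1, E2; split; lra.
Qed.

(** A leaf is won by one of the players, so [u] is inner. No child is secured for the player to
    move, and some child is not secured for the other player; that child serves for both. *)
Lemma unsecured_child {G : game} (Hwl : win_or_lose G) (i : player)
    (u : tree G) :
  ~ secured i u -> ~ secured (opponent i) u ->
  exists w, edge u w /\ ~ secured i w /\ ~ secured (opponent i) w.
Proof.
  intros Hi Ho.
  assert (Hu : ~ is_leaf u).
  { intros Hu; set (z := exist _ u Hu : leaf_node (tree G)).
    apply Hi, (secured_leaf i z), (win_or_lose_payoff Hwl).
    intros Hz; exact (Ho (secured_leaf _ z Hz)). }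
  set (n := exist _ u Hu : inner_node (tree G)).
  assert (Hown : forall j, turn n = j -> ~ secured j u ->
                   forall w : child u, ~ secured j (proj1_sig w))
    by (intros j Hj Hsec w Hw; exact (Hsec (secured_own j n w Hj Hw))).
  assert (Hopp : forall j, turn n = opponent j -> ~ secured j u ->
                   exists w : child u, ~ secured j (proj1_sig w))
    by (intros j Hj Hsec; apply not_all_ex_not; intros Hall;
        exact (Hsec (secured_opponent j n Hj Hall))).
  assert (Hinv : opponent (opponent i) = i) by now destruct i.
  destruct (player_or_opponent i (turn n)) as [Ht | Ht].
  (* By [Hinv], a node of [i] is a node of the opponent of [opponent i]. *)
  - destruct (Hopp (opponent i)) as [w Hw]; [congruence | assumption |].
    exists (proj1_sig w); split; [apply proj2_sig | split; [now apply Hown | exact Hw]].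
  - destruct (Hopp i Ht Hi) as [w Hw].
    exists (proj1_sig w); split; [apply proj2_sig | split; [exact Hw | now apply Hown]].
Qed.

(** Dependent choice: iterating the choice of a child in [P] would give an infinite path. *)
Lemma no_hereditary_child {G : game} (wf : well_founded_game G)
    (P : tree G -> Prop) :
  (forall u, P u -> exists w, edge u w /\ P w) -> forall u, ~ P u.
Proof.
  intros HP u Hu; apply wf.
  (* Each node carries its proof of [P], so that the choice can be repeated. *)
  pose (next := fun v : {v | P v} =>
    constructive_indefinite_description _ (HP (proj1_sig v) (proj2_sig v))).
  pose (f := fix f n := match n with
    | O => exist P u Hu
    | S m => exist P (proj1_sig (next (f m))) (proj2 (proj2_sig (next (f m))))
    end).
  exists (fun n => proj1_sig (f n)); intros n; simpl.
  exact (proj1 (proj2_sig (next (f n)))).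
Qed.

Lemma secured_determined {G : game} (wf : well_founded_game G)
    (Hwl : win_or_lose G) (i : player) (u : tree G) :
  secured i u \/ secured (opponent i) u.
Proof.
  apply NNPP; intros Hno; apply not_or_and in Hno.
  apply (no_hereditary_child wf
           (fun v => ~ secured i v /\ ~ secured (opponent i) v)) with (u := u);
    [| exact Hno].
  intros v [Hi Ho]; exact (unsecured_child Hwl i v Hi Ho).
Qed.

Lemma winning_strategies_incompatible {G : game} (wf : well_founded_game G)
    (Hwl : win_or_lose G) (i : player) (si : strategy G i)
    (so : strategy G (opponent i)) :
  winning_strategy wf i si -> ~ winning_strategy wf (opponent i) so.
Proof.
  intros Hi Ho.
  pose proof (proj1 (win_or_lose_payoff Hwl i _) (Hi so)) as Hne.
  (* Once [i] is concrete, joining [si] with [so] from either side gives the same joint strategy by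
     computation, hence the same leaf. *)
  destruct i; exact (Hne (Ho si)).
Qed.

Lemma eq_Empty_set {U : Type} (A : Ensemble U) :
  A = Empty_set U <-> forall x, ~ A x.
Proof.
  split.
  - intros -> x [].
  - intros HA; apply functional_extensionality; intros x.
    apply propositional_extensionality; split; [intros Hx; destruct (HA x Hx) | intros []].
Qed.

Theorem theorem14 (G : game) (wf : well_founded_game G) (Hwl : win_or_lose G)
    (i : player) :
  win wf i <> Empty_set (strategy G i) <->
  win wf (opponent i) = Empty_set (strategy G (opponent i)).
Proof.
  rewrite !eq_Empty_set; split.
  - intros Hi so Ho; apply Hi; intros si Hsi.
    exact (winning_strategies_incompatible wf Hwl i si so Hsi Ho).
  - intros Ho Hi.
    (* With both sets of winning strategies assumed empty, the greedy strategy of whoever secures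
       the root is a contradiction. *)
    destruct (secured_determined wf Hwl i root) as [H | H].
    + exact (Hi _ (secured_root_winning wf i H)).
    + exact (Ho _ (secured_root_winning wf (opponent i) H)).
Qed.
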